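(* Let $R$ be a Noetherian ring and let $I\subset R$ be a proper ideal of $R$ with $\operatorname{grade}(I)>0$. Suppose that $R_P/\mathfrak m_P$ is an infinite field for all $P\in V(I)$, and that the Rees ring $\mathcal R(I)$ satisfies Serre's condition $S_2$. Then $I$ satisfies the strong persistence property. In particular, $I^{k+1}:I=I^k$ for all $k$.
   Context: Rings are commutative with unit. $V(I)$ denotes the set of prime ideals of $R$ containing $I$. For $P\in\operatorname{Spec}(R)$, $\mathfrak m_P$ denotes the maximal ideal of the local ring $R_P$, and $I_P=IR_P$. The Rees ring of $I$ is $\mathcal R(I)=\bigoplus_{k\ge 0}I^k$. The condition $\operatorname{grade}(I)>0$ means that $I$ contains a non-zerodivisor of $R$. A Noetherian ring $A$ satisfies Serre's condition $S_2$ if $\operatorname{depth} A_Q\ge \min\{2,\dim A_Q\}$ for all $Q\in\operatorname{Spec}(A)$. Let $P\in V(I)$. The ideal $I$ satisfies the strong persistence property with respect to $P$ if for all integers $k\ge 1$ and all $f\in (I_P^k:\mathfrak m_P)\setminus I_P^k$ there exists $g\in I_P$ such that $fg\notin I_P^{k+1}$. The ideal $I$ satisfies the strong persistence property if it satisfies the strong persistence property with respect to every $P\in V(I)$. *)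

(* Defs.v *)
From HB Require Import structures.
From mathcomp Require Import all_boot all_order all_algebra.
From mathcomp Require Import generic_quotient ring.
From mathcomp Require Import boolp classical_sets functions cardinality.
From mathcomp Require Import constructive_ereal.

Set Implicit Arguments.
Unset Strict Implicit.
Unset Printing Implicit Defensive.

Import Order.TTheory GRing.Theory Num.Theory.

Local Open Scope classical_set_scope.
Local Open Scope ring_scope.
Local Open Scope quotient_scope.

Section Ideals.
Variable A : comNzRingType.
Implicit Types J K X : set A.

Definition is_ideal J : Prop :=
  [/\ J 0, (forall x y, J x -> J y -> J (x + y))
         & (forall a x, J x -> J (a * x))].

Definition is_prime J : Prop :=
  [/\ is_ideal J, ~ J 1 & forall x y, J (x * y) -> J x \/ J y].

Definition ideal_gen X : set A := smallest is_ideal X.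

Definition ideal_mul J K : set A :=
  ideal_gen [set z | exists x y, [/\ J x, K y & z = x * y]].

Definition ideal_pow J (k : nat) : set A := iter k (ideal_mul J) setT.

Definition colon J K : set A := [set x | forall y, K y -> J (x * y)].

Definition noetherian : Prop :=
  forall J, is_ideal J -> exists s : seq A, J = ideal_gen [set` s].

Lemma ideal_gen_ideal X : is_ideal (ideal_gen X).
Proof.
split=> [J [[]] //|x y Jx Jy J|a x Jx J] JX; have [[_ JD JM] _] := JX.
  by apply: JD; [exact: Jx|exact: Jy].
by apply: JM; exact: Jx.
Qed.

Lemma sub_ideal_gen X : X `<=` ideal_gen X.
Proof. by move=> x Xx J [_]; exact. Qed.

Lemma ideal_pow_ideal J k : is_ideal (ideal_pow J k).
Proof. by case: k => [|k]; [split|exact: ideal_gen_ideal]. Qed.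

Lemma ideal_powD J i j x y :
  ideal_pow J i x -> ideal_pow J j y -> ideal_pow J (i + j) (x * y).
Proof.
move=> Jx Jy; have [J0 JD JM] := ideal_pow_ideal J (i + j).
elim: i x Jx J0 JD JM => [|i IHi] x Jx J0 JD JM; first exact: JM.
apply: (Jx [set z | ideal_pow J (i.+1 + j) (z * y)]); split.
  split=> [|u v Ku Kv|a u Ku] /=; first by rewrite mul0r.
    by rewrite mulrDl; exact: JD.
  by rewrite -mulrA; exact: JM.
move=> _ [u [v [Ju Jv ->]]] /=; apply: sub_ideal_gen.
have [K0 KD KM] := ideal_pow_ideal J (i + j).
by exists u, (v * y); split; [|exact: IHi|rewrite mulrA].
Qed.

End Ideals.

Arguments noetherian A : clear implicits.

Record spec (A : comNzRingType) := Spec {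
  spec_set :> set A;
  spec_prime : is_prime spec_set }.

Section Localization.
Variables (A : comNzRingType) (P : spec A).

Definition loc_den := {s : A | `[< ~ spec_set P s >]}.

Implicit Types (s t : loc_den).

Fact loc_den1_subproof : `[< ~ spec_set P 1 >].
Proof. by apply/asboolP; case: (spec_prime P). Qed.

Definition loc_den1 : loc_den := exist _ 1 loc_den1_subproof.

Fact loc_denM_subproof s t : `[< ~ spec_set P (sval s * sval t) >].
Proof.
case: s t => [s /= /asboolP Ps] [t /= /asboolP Pt]; apply/asboolP.
by case: (spec_prime P) => _ _ PM /PM[].
Qed.

Definition loc_denM s t : loc_den :=
  exist _ (sval s * sval t) (loc_denM_subproof s t).

Implicit Types (x y z : A * loc_den).

Definition loc_eq x y : bool :=
  `[< exists u : loc_den,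
        sval u * (x.1 * sval y.2) = sval u * (y.1 * sval x.2) >].

Lemma loc_eq_refl : reflexive loc_eq.
Proof. by move=> x; apply/asboolP; exists loc_den1. Qed.

Lemma loc_eq_sym : symmetric loc_eq.
Proof.
by move=> x y; apply/asboolP/asboolP => -[u e]; exists u.
Qed.

Lemma loc_eq_trans : transitive loc_eq.
Proof.
move=> y x z /asboolP[u e] /asboolP[v f]; apply/asboolP.
exists (loc_denM (loc_denM u v) y.2) => /=.
transitivity (sval v * sval z.2 * (sval u * (x.1 * sval y.2))); first by ring.
by rewrite e; transitivity (sval u * sval x.2 * (sval v * (y.1 * sval z.2)));
  [ring|rewrite f; ring].
Qed.

Canonical loc_equiv := EquivRel loc_eq loc_eq_refl loc_eq_sym loc_eq_trans.

Definition loc := {eq_quot loc_eq}.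

HB.instance Definition _ : EqQuotient _ loc_eq loc := EqQuotient.on loc.
HB.instance Definition _ := Choice.on loc.

Definition frac (a : A) s : loc := \pi_loc (a, s).

Lemma fracP a s b t :
  frac a s = frac b t <->
  exists u : loc_den, sval u * (a * sval t) = sval u * (b * sval s).
Proof.
by split=> [/eqmodP/asboolP|e] //; apply/eqmodP/asboolP.
Qed.

Lemma fracW (Q : loc -> Prop) : (forall a s, Q (frac a s)) -> forall r, Q r.
Proof.
by move=> Qf x; rewrite -[x]reprK [repr x]surjective_pairing; exact: Qf.
Qed.

Definition loc_add (x y : loc) : loc :=
  let: (a, s) := repr x in let: (b, t) := repr y in
  frac (a * sval t + b * sval s) (loc_denM s t).

Definition loc_opp (x : loc) : loc :=
  let: (a, s) := repr x in frac (- a) s.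

Definition loc_mul (x y : loc) : loc :=
  let: (a, s) := repr x in let: (b, t) := repr y in
  frac (a * b) (loc_denM s t).

Lemma repr_frac a s : frac (repr (frac a s)).1 (repr (frac a s)).2 = frac a s.
Proof. by rewrite /frac -surjective_pairing reprK. Qed.

Lemma loc_addE a s b t :
  loc_add (frac a s) (frac b t) = frac (a * sval t + b * sval s) (loc_denM s t).
Proof.
rewrite /loc_add; move: (repr_frac a s) (repr_frac b t).
case: (repr _) => a' s'; case: (repr _) => b' t' /=.
move=> /fracP[u e] /fracP[v f]; apply/fracP; exists (loc_denM u v) => /=.
transitivity (sval v * sval t' * sval t * (sval u * (a' * sval s))
  + sval u * sval s' * sval s * (sval v * (b' * sval t))); first by ring.
by rewrite e f; ring.
Qed.

Lemma loc_oppE a s : loc_opp (frac a s) = frac (- a) s.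
Proof.
rewrite /loc_opp; move: (repr_frac a s); case: (repr _) => a' s' /=.
move=> /fracP[u e]; apply/fracP; exists u.
by rewrite !mulNr !mulrN e.
Qed.

Lemma loc_mulE a s b t :
  loc_mul (frac a s) (frac b t) = frac (a * b) (loc_denM s t).
Proof.
rewrite /loc_mul; move: (repr_frac a s) (repr_frac b t).
case: (repr _) => a' s'; case: (repr _) => b' t' /=.
move=> /fracP[u e] /fracP[v f]; apply/fracP; exists (loc_denM u v) => /=.
transitivity ((sval u * (a' * sval s)) * (sval v * (b' * sval t))).
  by ring.
by rewrite e f; ring.
Qed.

Lemma eq_frac a s b t : a * sval t = b * sval s -> frac a s = frac b t.
Proof. by move=> e; apply/fracP; exists loc_den1; rewrite e. Qed.

Lemma loc_addA : associative loc_add.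
Proof.
elim/fracW => a s; elim/fracW => b t; elim/fracW => c u.
by rewrite !loc_addE; apply: eq_frac => /=; ring.
Qed.

Lemma loc_addC : commutative loc_add.
Proof.
elim/fracW => a s; elim/fracW => b t.
by rewrite !loc_addE; apply: eq_frac => /=; ring.
Qed.

Lemma loc_add0 : left_id (frac 0 loc_den1) loc_add.
Proof. by elim/fracW => a s; rewrite loc_addE; apply: eq_frac => /=; ring. Qed.

Lemma loc_addN : left_inverse (frac 0 loc_den1) loc_opp loc_add.
Proof.
by elim/fracW => a s; rewrite loc_oppE loc_addE; apply: eq_frac => /=; ring.
Qed.

HB.instance Definition _ :=
  GRing.isZmodule.Build loc loc_addA loc_addC loc_add0 loc_addN.

Lemma loc_mulA : associative loc_mul.
Proof.
elim/fracW => a s; elim/fracW => b t; elim/fracW => c u.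
by rewrite !loc_mulE; apply: eq_frac => /=; ring.
Qed.

Lemma loc_mulC : commutative loc_mul.
Proof.
elim/fracW => a s; elim/fracW => b t.
by rewrite !loc_mulE; apply: eq_frac => /=; ring.
Qed.

Lemma loc_mul1 : left_id (frac 1 loc_den1) loc_mul.
Proof. by elim/fracW => a s; rewrite loc_mulE; apply: eq_frac => /=; ring. Qed.

Lemma loc_mulDl : left_distributive loc_mul loc_add.
Proof.
elim/fracW => a s; elim/fracW => b t; elim/fracW => c u.
by rewrite !(loc_addE, loc_mulE); apply: eq_frac => /=; ring.
Qed.

Lemma loc_oner_neq0 : frac 1 loc_den1 != 0 :> loc.
Proof.
apply/eqP => /fracP[[u /asboolP Pu]] /=; rewrite !mulr1 mulr0 => u0.
by apply: Pu; rewrite u0; case: (spec_prime P) => -[].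
Qed.

HB.instance Definition _ := GRing.Zmodule_isComNzRing.Build loc
  loc_mulA loc_mulC loc_mul1 loc_mulDl loc_oner_neq0.

Definition to_loc (a : A) : loc := frac a loc_den1.

Definition loc_ideal (J : set A) : set loc := ideal_gen (to_loc @` J).

End Localization.

Section LocalRings.
Variable A : comNzRingType.

(* The set of nonunits, which is the maximal ideal as soon as [A] is local. *)
Definition max_ideal : set A := [set x | ~ exists y, x * y = 1].

Definition ideal_coset (J : set A) (x : A) : set A := [set y | J (y - x)].

Definition residue_infinite : Prop :=
  infinite_set [set ideal_coset max_ideal x | x in [set: A]].

Definition regular_seq (s : seq A) : Prop :=
  (forall i, (i < size s)%N -> forall y,
     ideal_gen [set` take i s] (s`_i * y) -> ideal_gen [set` take i s] y) /\
  ideal_gen [set` s] <> setT.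

(* Suprema of sets of natural numbers, taken in the complete chain [\bar int]:
   [-oo] for the empty set and [+oo] for unbounded sets. *)
Definition nat_sup (S : set nat) : \bar int :=
  supremum -oo%E [set (n%:Z)%:E | n in S].

(* The depth of [A] when [A] is a Noetherian local ring. *)
Definition depth : \bar int :=
  nat_sup [set n | exists s : seq A,
    [/\ size s = n, [set` s] `<=` max_ideal & regular_seq s]].

Definition krull_dim : \bar int :=
  nat_sup [set n | exists c : nat -> spec A,
    forall i, (i < n)%N -> c i `<` c i.+1].

End LocalRings.

Arguments max_ideal A : clear implicits.
Arguments residue_infinite A : clear implicits.
Arguments depth A : clear implicits.
Arguments krull_dim A : clear implicits.

Lemma max_idealE (A : comNzRingType) (P : spec A) :
  max_ideal (loc P) = loc_ideal P :> set (loc P).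
Proof.
have [[P0 PD PM] P1 PP] := spec_prime P.
have H (a : A) (s : loc_den P) : max_ideal (loc P) (frac a s) <-> spec_set P a.
  split=> [nu|Pa [y]].
    apply: contrapT => Pa; apply: nu.
    have Pa' : `[< ~ spec_set P a >] by exact/asboolP.
    exists (frac (sval s) (exist _ a Pa' : loc_den P)).
    by rewrite [LHS]loc_mulE; apply: eq_frac => /=; ring.
  elim/fracW: y => b t; rewrite [X in X = _]loc_mulE.
  move=> /fracP[[u /asboolP Pu]] /=; rewrite mulr1 mul1r => e.
  have : spec_set P (u * (sval s * sval t)).
    by rewrite -e mulrCA mulrC; exact: PM.
  case/PP => // /PP[]; first by case: s {e} => /= ? /asboolP.
  by case: t {e} => /= ? /asboolP.
apply/seteqP; split.
  elim/fracW => a s /H Pa J [[_ _ JM] JP].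
  have -> : frac a s = frac 1 s * to_loc P a.
    by rewrite [RHS]loc_mulE; apply: eq_frac => /=; ring.
  by apply: JM; apply: JP; exists a.
move=> x; apply; split; last by move=> _ [a Pa <-]; apply/H.
split; first by apply/H.
- elim/fracW => a s; elim/fracW => b t /H Pa /H Pb.
  by rewrite [_ + _]loc_addE; apply/H; apply: PD; rewrite mulrC; exact: PM.
- elim/fracW => a s; elim/fracW => b t /H Pb.
  by rewrite [_ * _]loc_mulE; apply/H; exact: PM.
Qed.

Definition serre_S2 (A : comNzRingType) : Prop :=
  forall Q : spec A,
    (Order.min (2%:Z)%:E (krull_dim (loc Q)) <= depth (loc Q))%E.

Section Rees.
Variables (A : comNzRingType) (I : set A).

(* The graded ring of all [I^k] (k in nat), realized as the subring [A[It]] of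
   [A[t]]: the coefficient of [t^k] is the component of degree [k]. *)
Definition rees_pred : {pred {poly A}} :=
  fun p => `[< forall k, ideal_pow I k p`_k >].

Fact rees_subring : subring_closed rees_pred.
Proof.
split=> [|p q|p q].
- apply/asboolP => k; rewrite coef1; case: k => [|k] //=.
  by case: (ideal_pow_ideal I k.+1).
- move=> /asboolP Ip /asboolP Iq; apply/asboolP => k; rewrite coefB -mulN1r.
  by case: (ideal_pow_ideal I k) => _ ID IM; apply: ID => //; exact: IM.
- move=> /asboolP Ip /asboolP Iq; apply/asboolP => k; rewrite coefM.
  have [I0 ID _] := ideal_pow_ideal I k.
  elim/big_ind: _ => // i _.
  by have := ideal_powD (Ip i) (Iq (k - i)%N); rewrite subnKC // -ltnS.
Qed.

HB.instance Definition _ :=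
  GRing.isSubringClosed.Build {poly A} rees_pred rees_subring.

Record rees := Rees { rees_val : {poly A}; _ : rees_val \in rees_pred }.

HB.instance Definition _ := [isSub for rees_val].
HB.instance Definition _ := [Choice of rees by <:].
HB.instance Definition _ := [SubChoice_isSubComNzRing of rees by <:].

End Rees.

Section StrongPersistence.
Variables (A : comNzRingType) (I : set A).

Definition strong_persistence_at (P : spec A) : Prop :=
  forall (k : nat) (f : loc P), (1 <= k)%N ->
    (colon (ideal_pow (loc_ideal I) k) (max_ideal (loc P))
      `\` ideal_pow (loc_ideal I) k) f ->
    exists2 g, loc_ideal I g & ~ ideal_pow (loc_ideal I) k.+1 (f * g).

Definition strong_persistence : Prop :=
  forall P : spec A, I `<=` P -> strong_persistence_at P.

End StrongPersistence.

(* Main.v *)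
Require Import Defs.
From mathcomp Require Import all_boot all_order all_algebra.
From mathcomp Require Import boolp classical_sets.
From mathcomp Require Import ring constructive_ereal.

(* Only [I^(k+1) : I = I^k] needs proof: since [I] is finitely generated, this
   equality localizes, and it contradicts any failure of strong persistence.

   Let [f I] lie in [I^(k+1)] and [f] not in [I^k]. Multiplying [f] by a scalar,
   we may assume that [P = (I^k : f)] is prime; it contains [I]. Write [S] for
   the Rees ring [R[It]], let [Q] be the prime of the [u] in [S] with constant
   coefficient in [P], and let [x] in [I] be regular on [R]. As [f I^i] lies in
   [I^(i+k)] for [i > 0], the ideal [(x S : x f t^k)] contains [Q]. If [p] is a
   prime inside [P] avoiding [x], the primes [p R[t] /\ S], [(p, It)] and
   [Q = (P, It)] form a strict chain, so [S_Q] has dimension, hence depth, at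
   least two. Then [Q S_Q] kills no nonzero element of [S_Q / x S_Q], so
   [x f t^k] lies in [x S_Q], that is, [u f] lies in [I^k] for some [u]
   outside [P]: a contradiction. *)

Set Implicit Arguments.
Unset Strict Implicit.
Unset Printing Implicit Defensive.

Import Order.TTheory GRing.Theory Num.Theory.
(* [fraction] also defines a constant [frac]. *)
Import Defs.

Local Open Scope classical_set_scope.
Local Open Scope ring_scope.

(** * Suprema of sets of natural numbers *)

Lemma nat_supremums_ereal (S : set nat) : S !=set0 ->
  supremums [set (n%:Z)%:E | n in S] !=set0.
Proof.
move=> [n0 Sn0].
(* As [S] is nonempty, -oo is no upper bound and every finite one is a natural number; the least
   upper bound is thus a maximum or +oo. *)
have fin_ub b : ubound [set (n%:Z)%:E | n in S] b -> (b < +oo)%E ->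
    exists2 m, ubound S m & b = (m%:Z)%:E.
  case: b => [r| |] // ub _; last by have := ub _ (imageP _ Sn0).
  have r_ge n : S n -> n%:Z <= r.
    by move=> Sn; rewrite -lee_fin; apply: ub; exists n.
  have /gez0_abs r0 : 0 <= r by apply: le_trans (r_ge _ Sn0).
  exists `|r|%N; last by rewrite r0.
  by move=> n /r_ge; rewrite -{1}r0 lez_nat.
have [S_ub|S_ub] := pselect (ubound S !=set0); last first.
  exists +oo%E; split=> [x _|b /fin_ub ub]; first exact: leey.
  rewrite leNgt; apply/negP => /ub[m Sm _].
  by apply: S_ub; exists m.
have [m [mS Sm]] := nat_supremums_neq0 S_ub.
exists (m%:Z)%:E; split=> [_ [n Sn <-]|b ub].
  by rewrite lee_fin lez_nat; exact: mS.
rewrite leNgt; apply/negP => ltbm.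
have [m' Sm' bE] := fin_ub _ ub (lt_le_trans ltbm (leey _)).
by move: ltbm; rewrite bE lte_fin ltz_nat ltnNge => /negP; apply; exact: Sm.
Qed.

Lemma nat_sup_ub (S : set nat) n : S n -> ((n%:Z)%:E <= nat_sup S)%E.
Proof.
move=> Sn; apply: ge_supremum_Nmem; last by exists n.
by apply: nat_supremums_ereal; exists n.
Qed.

Lemma nat_sup_le (S : set nat) n : ubound S n -> (nat_sup S <= (n%:Z)%:E)%E.
Proof.
move=> Sn; rewrite /nat_sup /supremum; case: ifPn => [_|/set0P[_ [m Sm _]]].
  exact: leNye.
case: xgetP => [b _ [_]|]; first apply.
  by move=> _ [k Sk <-]; rewrite lee_fin lez_nat; exact: Sn.
have [b Sb] : supremums [set (k%:Z)%:E | k in S] !=set0.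
  by apply: nat_supremums_ereal; exists m.
by move=> /(_ b).
Qed.

(** * Depth two, maximal members of families of ideals, and primes *)

Section Generators.
Variable A : comNzRingType.
Implicit Types (J : set A).

Lemma ideal_gen_sub (X J : set A) :
  is_ideal J -> X `<=` J -> ideal_gen X `<=` J.
Proof. by move=> iJ XJ x; apply. Qed.

Lemma ideal_gen1 (a y : A) : ideal_gen [set` [:: a]] y <-> exists c, y = a * c.
Proof.
split; last first.
  move=> [c ->]; rewrite mulrC; have [_ _ GM] := ideal_gen_ideal [set` [:: a]].
  by apply: GM; apply: sub_ideal_gen; rewrite /= inE.
move: y; apply: ideal_gen_sub.
  split=> [|_ _ [c ->] [d ->]|b _ [c ->]]; first by exists 0; rewrite mulr0.
    by exists (c + d); rewrite mulrDr.
  by exists (b * c); rewrite mulrCA.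
by move=> x /=; rewrite inE => /eqP ->; exists 1; rewrite mulr1.
Qed.

(** A supremum of at least 2 forces a regular sequence with two terms or more, since otherwise all
    lengths are at most 1; its first two terms serve. *)
Lemma depth_ge2 : ((2%:Z)%:E <= depth A)%E ->
  exists a b : A, [/\ max_ideal A a, max_ideal A b,
    forall y, a * y = 0 -> y = 0
  & forall y c, b * y = a * c -> exists d, y = a * d].
Proof.
move=> dA; apply: contrapT => nreg.
suff : (depth A <= (1%:Z)%:E)%E by move=> /(le_trans dA).
apply: nat_sup_le => _ [s [<- sm [sreg _]]]; rewrite leNgt; apply/negP => s2.
apply: nreg; case: s sm sreg s2 => [|a [|b s]] //= sm sreg _.
exists a, b; split=> [||y ay|y c bc].
- by apply: sm; rewrite /= inE eqxx.
- by apply: sm; rewrite /= !inE eqxx orbT.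
(* The ideal generated by no element lies in [[set 0]]. *)
- apply: (sreg 0 isT y _ [set 0]).
    by rewrite /= ay; case: (ideal_gen_ideal [set` Nil A]).
  split; last by move=> ? /=.
  by split=> [//|_ _ -> ->|? _ ->]; rewrite /= ?addr0 ?mulr0.
- by apply/ideal_gen1; apply: (sreg 1%N isT y); apply/ideal_gen1; exists c.
Qed.

(* [z] is a socle element modulo [y]; with [a], [b] regular, [a z = y c] and
   [b z = y d] give [b c = a d], hence [c = a e] and [z = y e]. *)
Lemma depth2_socle (y z : A) : ((2%:Z)%:E <= depth A)%E ->
  (forall w, y * w = 0 -> w = 0) ->
  (forall a, max_ideal A a -> exists c, a * z = y * c) ->
  exists e, z = y * e.
Proof.
move=> /depth_ge2[a [b [ma mb a_reg b_reg]]] y_reg yz.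
have [[c az] [d bz]] := (yz _ ma, yz _ mb).
have [e ce] : exists e, c = a * e.
  apply: (b_reg c d); apply: subr0_eq; apply: y_reg.
  transitivity (b * (y * c) - a * (y * d)); first by ring.
  by rewrite -az -bz; ring.
exists e; apply: subr0_eq; apply: a_reg.
by rewrite mulrBr az ce; ring.
Qed.

(** Without a maximal member, choice builds a strictly increasing chain; its union is an ideal whose
    finitely many generators already lie in one member. *)
Lemma noetherian_max (F : set (set A)) : noetherian A ->
  (forall J, F J -> is_ideal J) -> F !=set0 ->
  exists2 J, F J & forall K, F K -> J `<=` K -> K = J.
Proof.
move=> noethA Fi [J0 FJ0]; apply: contrapT => nmax.
have [next nextP] : {next : {J | F J} -> {J | F J} &
    forall J : {J | F J}, sval J `<` sval (next J)}.
  apply: (choice (P := fun J K : {J | F J} => sval J `<` sval K)).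
  move=> [J FJ]; apply: contrapT => nJ; apply: nmax.
  exists J => // K FK JK; apply: contrapT => KJ; apply: nJ.
  exists (exist _ K FK); split=> //= KsJ; apply: KJ.
  by apply/seteqP.
pose c n := sval (iter n next (exist _ J0 FJ0)).
have Fc n : F (c n) := svalP _.
have c_lt n : c n `<` c n.+1 by exact: nextP.
have c_le m n : (m <= n)%N -> c m `<=` c n.
  elim: n => [|n IHn]; first by rewrite leqn0 => /eqP ->.
  rewrite leq_eqVlt => /predU1P[-> //|/IHn mn].
  by apply: subset_trans mn _; case: (c_lt n).
pose U := [set x | exists n, c n x].
have iU : is_ideal U.
  split=> [|x y [m xm] [n yn]|a x [n xn]].
  - by exists 0%N; case: (Fi _ (Fc 0%N)).
  - exists (maxn m n); have [_ cD _] := Fi _ (Fc (maxn m n)).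
    apply: cD; first by apply: c_le xm; rewrite leq_maxl.
    by apply: c_le yn; rewrite leq_maxr.
  - by exists n; have [_ _ cM] := Fi _ (Fc n); exact: cM.
have [s Us] := noethA _ iU.
have [n sn] : exists n, [set` s] `<=` c n.
  have : [set` s] `<=` U by rewrite Us; exact: sub_ideal_gen.
  elim: s {Us} => [|x s IHs] sU; first by exists 0%N.
  have [|n sn] := IHs.
    by move=> y ys; apply: sU; rewrite /= inE; apply/orP; right.
  have [|m xm] := sU x; first by rewrite /= inE eqxx.
  exists (maxn m n) => y /=; rewrite inE => /predU1P[->|/sn].
    by apply: c_le xm; rewrite leq_maxl.
  by apply: c_le; rewrite leq_maxr.
have [_ []] := c_lt n => x xc.
have : U x by exists n.+1.
by rewrite Us => /(ideal_gen_sub (Fi _ (Fc n)) sn).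
Qed.

(** Among the proper ideals (J : s f), a maximal one is prime: if [y] lies outside it, then (J : y s
    f) is again proper and contains it, so equals it. *)
Lemma associated_prime J f : noetherian A -> is_ideal J -> ~ J f ->
  exists s, is_prime [set r | J (r * (s * f))].
Proof.
move=> noethA [J0 JD JM] Jf.
have colon_ideal g : is_ideal [set r | J (r * g)].
  split=> [|x y Jx Jy|a x Jx] /=; first by rewrite mul0r.
    by rewrite mulrDl; exact: JD.
  by rewrite -mulrA; exact: JM.
pose F := [set K | exists s, ~ J (s * f) /\ K = [set r | J (r * (s * f))]].
have [||_ [s [sf ->]] Fmax] := noetherian_max (F := F) noethA.
- by move=> _ [s [_ ->]]; exact: colon_ideal.
- by exists [set r | J (r * (1 * f))]; exists 1; rewrite mul1r.
exists s; split=> [//||x y /= Jxy]; first by rewrite /= mul1r.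
have [Jy|Jy] := pselect (J (y * (s * f))); [by right|left].
have /seteqP[/(_ x) + _] :
    [set r | J (r * (y * s * f))] = [set r | J (r * (s * f))].
  apply: Fmax; first by exists (y * s); rewrite -mulrA.
  by move=> r Jr /=; rewrite -!mulrA mulrCA; exact: JM.
by apply; rewrite /= -[y * s * f]mulrA mulrA.
Qed.

(** The products s x^n with [s] outside [P] form a multiplicative set that omits 0, as [x] is
    regular. An ideal maximal among those missing it is prime; it lies in [P] and avoids [x] because
    the set contains every such [s] and [x] itself. *)
Lemma prime_below (P : spec A) x : noetherian A -> GRing.lreg x ->
  exists2 p : spec A, p `<=` P & ~ spec_set p x.
Proof.
move=> noethA x_reg; have [[P0 PD PM] P1 PP] := spec_prime P.
pose F := [set K | is_ideal K /\
  forall s n, ~ spec_set P s -> ~ K (s * x ^+ n)].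
have [||p [ip pF] pmax] := noetherian_max (F := F) noethA.
- by move=> K [].
- exists [set 0]; split.
    by split=> [//|_ _ -> ->|? _ ->]; rewrite /= ?addr0 ?mulr0.
  move=> s n Ps sx; apply: Ps.
  suff -> : s = 0 by [].
  elim: n sx => [|n IHn]; first by rewrite /= mulr1.
  rewrite /= exprS mulrCA => sx; apply: IHn; apply: x_reg.
  by rewrite sx mulr0.
have [p0 pD pM] := ip.
(* By maximality, adjoining to [p] an element outside it yields an ideal that meets the
   multiplicative set. *)
have meets a : ~ p a ->
    exists s n r q, [/\ ~ spec_set P s, p q & s * x ^+ n = q + r * a].
  move=> pa; apply: contrapT => nmeets; apply: pa.
  pose K := [set u | exists q r, p q /\ u = q + r * a].
  suff <- : K = p by exists 0, 1; rewrite add0r mul1r.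
  apply: pmax; last by move=> q pq; exists q, 0; rewrite mul0r addr0.
  split.
    split=> [|_ _ [q [r [pq ->]]] [q' [r' [pq' ->]]]|b _ [q [r [pq ->]]]].
    - by exists 0, 0; rewrite mul0r addr0.
    - by exists (q + q'), (r + r'); split; [exact: pD|ring].
    - by exists (b * q), (b * r); split; [exact: pM|ring].
  move=> s n Ps [q [r [pq e]]]; apply: nmeets.
  by exists s, n, r, q.
have pP : is_prime p.
  split=> // [p1|a b pab].
    by apply: (pF 1 0%N P1); rewrite mulr1.
  apply: contrapT => /not_orP[/meets[s [n [r [q [Ps pq e]]]]]].
  move=> /meets[s' [n' [r' [q' [Ps' pq' e']]]]].
  apply: (pF (s * s') (n + n')%N); first by case/PP.
  have -> : s * s' * x ^+ (n + n') =
      (q' + r' * b) * q + (r * a) * q' + (r * r') * (a * b).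
    by rewrite exprD; transitivity ((s * x ^+ n) * (s' * x ^+ n'));
      [ring|rewrite e e'; ring].
  by apply: (pD); [apply: (pD)|]; exact: pM.
exists (Spec pP) => [s ps|px] /=.
  by apply: contrapT => Ps; apply: (pF s 0%N Ps); rewrite mulr1.
by apply: (pF 1 1%N P1); rewrite mul1r.
Qed.

End Generators.

(** * Ideals and primes of a localization *)

Section LocalizationTheory.
Variables (A : comNzRingType) (P : spec A).
Implicit Types (J K : set A) (s t : loc_den P).

Lemma fracD a s b t :
  frac a s + frac b t = frac (a * sval t + b * sval s) (loc_denM s t).
Proof. exact: loc_addE. Qed.

Lemma fracM a s b t : frac a s * frac b t = frac (a * b) (loc_denM s t).
Proof. exact: loc_mulE. Qed.

Lemma fracE a s : frac a s = frac 1 s * to_loc P a.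
Proof. by rewrite fracM; apply: eq_frac => /=; ring. Qed.

Lemma loc_denP s : ~ spec_set P (sval s).
Proof. by case: s => s /= /asboolP. Qed.

Definition loc_den_of u (Pu : ~ spec_set P u) : loc_den P :=
  exist _ u (asboolT Pu).

Lemma loc_idealP J (r : loc P) : is_ideal J ->
  loc_ideal J r <-> exists a s, J a /\ r = frac a s.
Proof.
move=> [J0 JD JM]; split; last first.
  move=> [a [s [Ja ->]]]; rewrite fracE.
  have [_ _ GM] := ideal_gen_ideal (to_loc P @` J).
  by apply: GM; apply: sub_ideal_gen; exists a.
move: r; apply: ideal_gen_sub; last first.
  by move=> _ [a Ja <-]; exists a, (loc_den1 P).
split=> [|_ _ [a [s [Ja ->]]] [b [t [Jb ->]]]|x _ [b [t [Jb ->]]]].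
- by exists 0, (loc_den1 P).
- exists (a * sval t + b * sval s), (loc_denM s t); split; last exact: fracD.
  by apply: JD; rewrite mulrC; exact: JM.
- elim/fracW: x => a s; exists (a * b), (loc_denM s t).
  by split; [exact: JM|exact: fracM].
Qed.

Lemma loc_idealM J K : is_ideal J -> is_ideal K ->
  ideal_mul (loc_ideal J) (loc_ideal K) =
  loc_ideal (ideal_mul J K) :> set (loc P).
Proof.
move=> iJ iK; apply/seteqP; split.
  apply: ideal_gen_sub; first exact: ideal_gen_ideal.
  move=> _ [x [y [Jx Ky ->]]].
  have /(loc_idealP _ iJ)[a [s [Ja ->]]] := Jx.
  have /(loc_idealP _ iK)[b [t [Kb ->]]] := Ky.
  rewrite fracM; apply/loc_idealP; first exact: ideal_gen_ideal.
  exists (a * b), (loc_denM s t); split=> //.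
  by apply: sub_ideal_gen; exists a, b.
apply: ideal_gen_sub; first exact: ideal_gen_ideal.
move=> _ [c JKc <-].
have [G0 GD GM] :
    is_ideal (ideal_mul (loc_ideal J) (loc_ideal K) : set (loc P)).
  exact: ideal_gen_ideal.
apply: (JKc [set c | ideal_mul (loc_ideal J) (loc_ideal K) (to_loc P c)]).
split.
  split=> [//|x y Gx Gy|a x Gx] /=.
    have -> : to_loc P (x + y) = to_loc P x + to_loc P y.
      by rewrite fracD; apply: eq_frac => /=; ring.
    exact: GD.
  have -> : to_loc P (a * x) = to_loc P a * to_loc P x.
    by rewrite fracM; apply: eq_frac => /=; ring.
  exact: GM.
move=> _ [a [b [Ja Kb ->]]] /=; apply: sub_ideal_gen.
exists (to_loc P a), (to_loc P b); split.
- by apply: sub_ideal_gen; exists a.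
- by apply: sub_ideal_gen; exists b.
- by rewrite fracM; apply: eq_frac => /=; ring.
Qed.

Lemma loc_ideal_pow J n : is_ideal J ->
  ideal_pow (loc_ideal J) n = loc_ideal (ideal_pow J n) :> set (loc P).
Proof.
move=> iJ; elim: n => [|n IHn].
  apply/esym/seteqP; split=> // r _; apply/loc_idealP => //.
  by elim/fracW: r => a s; exists a, s.
by rewrite /= -/(ideal_pow _ n) IHn loc_idealM //; exact: ideal_pow_ideal.
Qed.

(** The numerator itself may fall outside [J]: equality of fractions holds only up to a factor
    outside [P]. *)
Lemma loc_ideal_frac J a s : is_ideal J -> loc_ideal J (frac a s) ->
  exists2 u, ~ spec_set P u & J (u * a).
Proof.
move=> iJ /(loc_idealP _ iJ)[b [t [Jb /fracP[u e]]]].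
exists (sval (loc_denM u t)); first exact: loc_denP.
have -> : sval (loc_denM u t) * a = sval u * sval s * b.
  by transitivity (sval u * (a * sval t)); [rewrite /=; ring|rewrite e; ring].
by have [_ _ JM] := iJ; exact: JM.
Qed.

Lemma loc_ideal_prime (p : spec A) a s : p `<=` P ->
  loc_ideal p (frac a s) <-> spec_set p a.
Proof.
move=> pP; have [ip _ pM] := spec_prime p; split=> [|pa]; last first.
  by apply/loc_idealP => //; exists a, s.
by move=> /(loc_ideal_frac ip)[u Pu /pM[/pP|]].
Qed.

Lemma loc_prime (p : spec A) : p `<=` P -> is_prime (loc_ideal p : set (loc P)).
Proof.
move=> pP; have [_ p1 pM] := spec_prime p; split; first exact: ideal_gen_ideal.
  by move=> /(loc_ideal_prime _ _ pP).
elim/fracW => a s; elim/fracW => b t.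
by rewrite fracM => /loc_ideal_prime -/(_ pP)/pM[] ?;
  [left|right]; apply/loc_ideal_prime.
Qed.

Lemma krull_dim_loc_ge2 (p0 p1 : spec A) : p0 `<` p1 -> p1 `<` P ->
  ((2%:Z)%:E <= krull_dim (loc P))%E.
Proof.
move=> p01 p1P; have p1P' : p1 `<=` P by case: p1P.
have p0P' : p0 `<=` P by apply: subset_trans p1P'; case: p01.
have mono (p q : spec A) (pP : p `<=` P) (qP : q `<=` P) :
    p `<` q -> Spec (loc_prime pP) `<` Spec (loc_prime qP).
  move=> [pq nqp]; split=> [|qp].
    elim/fracW=> a s /(loc_ideal_prime _ _ pP)/pq qa.
    exact/(loc_ideal_prime _ _ qP).
  apply: nqp => a qa; apply/(loc_ideal_prime _ (loc_den1 P) pP).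
  by apply: qp; apply/loc_ideal_prime.
apply: nat_sup_ub.
(* Only the inclusions at i < 2 matter, so the chain stays constant from index 2 on. *)
exists (fun i => if i is i'.+1 then
    if i' is _.+1 then Spec (loc_prime (@subset_refl _ P))
    else Spec (loc_prime p1P')
  else Spec (loc_prime p0P')).
by case=> [|[|]] // _; exact: mono.
Qed.

End LocalizationTheory.

(** * Primes and products in the Rees ring *)

Section ReesTheory.
Variables (A : comNzRingType) (I : set A).
Implicit Types (p : spec A) (u v : rees I).

Lemma rees_coef u i : ideal_pow I i (rees_val u)`_i.
Proof. by case: u => u /= /asboolP. Qed.

(** The preimage of [p] under the ring map taking the constant coefficient: the ideal (p, It). *)
Lemma rees_coef0_prime p :
  is_prime [set u : rees I | spec_set p (rees_val u)`_0].
Proof.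
have [[p0 pD pM] p1 pP] := spec_prime p; split.
- split=> [|u v pu pv|u v pv] /=; first by rewrite coef0.
    by rewrite coefD; exact: pD.
  by rewrite coef0M; exact: pM.
- by rewrite /= coef1.
- by move=> u v /=; rewrite coef0M; exact: pP.
Qed.

(** The contraction of p A[t]; primality follows as in Gauss's lemma, from the first coefficients of
    [u] and [v] outside [p]. *)
Lemma rees_coef_prime p :
  is_prime [set u : rees I | forall i, spec_set p (rees_val u)`_i].
Proof.
have [[p0 pD pM] p1 pP] := spec_prime p.
have psum n (F : 'I_n -> A) (Q : pred 'I_n) :
    (forall i, Q i -> spec_set p (F i)) -> spec_set p (\sum_(i | Q i) F i).
  by move=> pF; elim/big_ind: _.
split.
- split=> [|u v pu pv|u v pv] /= i; first by rewrite coef0.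
    by rewrite coefD; exact: pD.
  by rewrite coefM; apply: psum => j _; exact: pM.
- by move=> /(_ 0%N) /=; rewrite coef1.
- move=> u v /= puv; apply: contrapT => /not_orP[/existsNP nu /existsNP nv].
  have first_coef (w : rees I) : (exists i, ~ spec_set p (rees_val w)`_i) ->
      exists2 i, ~ spec_set p (rees_val w)`_i
        & forall j, (j < i)%N -> spec_set p (rees_val w)`_j.
    move=> [i wi].
    have ex : exists i, `[< ~ spec_set p (rees_val w)`_i >].
      by exists i; apply/asboolP.
    case: (ex_minnP ex) => m /asboolP wm mmin; exists m => // j jm.
    apply: contrapT => /asboolP/mmin; by rewrite leqNgt jm.
  have [[m um mmin] [n vn nmin]] := (first_coef _ nu, first_coef _ nv).
  have : spec_set p ((rees_val u)`_m * (rees_val v)`_n).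
    have := puv (m + n)%N; rewrite /= coefM.
    have mlt : (m < (m + n).+1)%N by rewrite ltnS leq_addr.
    (* Every other term of this coefficient has a factor of index below [m] from [u] or below [n]
       from [v], hence lies in [p]. *)
    rewrite (bigD1 (Ordinal mlt)) //= addKn.
    set a := _ * _; set b := \sum_(_ < _ | _) _ => pab.
    have pb : spec_set p b.
      apply: psum => i im; have [/mmin ui|mi] := ltnP i m.
        by rewrite mulrC; exact: pM.
      apply: pM; apply: nmin; have i_le : (i <= m + n)%N by rewrite -ltnS.
      rewrite -(ltn_add2l i) subnKC // ltn_add2r.
      rewrite ltn_neqAle mi andbT eq_sym.
      by apply: contra im => /eqP e; apply/eqP/val_inj.
    have -> : a = (a + b) + (-1) * b by ring.
    by apply: pD => //; exact: pM.
  by case/pP.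
Qed.

(** For [b] in I and [c] in I^i, the product b c g = c (g b) lies in I^i I^(k+1). One factor from I
    is spent on [g], hence the positive exponent [i.+1]. *)
Lemma ideal_pow_colon g k i a : (forall y, I y -> ideal_pow I k.+1 (g * y)) ->
  ideal_pow I i.+1 a -> ideal_pow I (i.+1 + k) (a * g).
Proof.
move=> gI; have [J0 JD JM] := ideal_pow_ideal I (i.+1 + k).
move: a; apply: (@ideal_gen_sub _ _ [set a | ideal_pow I (i.+1 + k) (a * g)]).
  split=> [|a b Ja Jb|a b Jb] /=; first by rewrite mul0r.
    by rewrite mulrDl; exact: JD.
  by rewrite -mulrA; exact: JM.
move=> _ [b [c [Ib Ic ->]]] /=.
have := ideal_powD Ic (gI _ Ib); rewrite addnS -addSn.
by congr (ideal_pow I _ _); ring.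
Qed.

End ReesTheory.

(** * The equality I^(k+1) : I = I^k *)

Lemma colon_pow_S2 (R : comNzRingType) (I : set R) (k : nat) :
  noetherian R -> (exists2 x, I x & GRing.lreg x) ->
  serre_S2 (rees I) ->
  colon (ideal_pow I k.+1) I = ideal_pow I k.
Proof.
move=> noethR [x Ix x_reg] S2.
have [_ _ JM] := ideal_pow_ideal I k.
apply/seteqP; split=> [f fI|f If y Iy]; last first.
  by rewrite mulrC; apply: sub_ideal_gen; exists y, f.
apply: contrapT => nIf.
have [s pP] := associated_prime noethR (ideal_pow_ideal I k) nIf.
pose P := Spec pP; pose g := s * f.
have gI y : I y -> ideal_pow I k.+1 (g * y).
  move=> Iy; rewrite /g -mulrA.
  by have [_ _ M] := ideal_pow_ideal I k.+1; apply: M; exact: fI.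
have Ik1 : ideal_pow I k.+1 `<=` ideal_pow I k.
  apply: ideal_gen_sub; first exact: ideal_pow_ideal.
  by move=> _ [a [b [_ Ib ->]]]; exact: JM.
have IP : I `<=` P by move=> y /gI /Ik1; rewrite mulrC.
have [p pP' px] := prime_below P noethR x_reg.
pose Q := Spec (rees_coef0_prime I P).
have yI : x%:P \in rees_pred I.
  apply/asboolP => -[|i] //; rewrite coefC /=.
  by case: (ideal_pow_ideal I i.+1).
have xtI : x *: 'X \in rees_pred I.
  apply/asboolP => i; rewrite coefZ coefX.
  case: eqP => [->|_]; last by rewrite mulr0; case: (ideal_pow_ideal I i).
  by apply: sub_ideal_gen; exists x, 1.
(* The monomial g t^k is outside the Rees ring; the factor [x] brings its coefficient into I^k. *)
have zI : (x * g) *: 'X^k \in rees_pred I.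
  apply/asboolP => i; rewrite coefZ coefXn.
  case: eqP => [->|_]; last by rewrite mulr0; case: (ideal_pow_ideal I i).
  by rewrite mulr1 mulrC; apply: Ik1; exact: gI.
pose y := Rees yI; pose z := Rees zI.
have dimQ : ((2%:Z)%:E <= krull_dim (loc Q))%E.
  apply: (krull_dim_loc_ge2 (p0 := Spec (rees_coef_prime I p))
    (p1 := Spec (rees_coef0_prime I p))).
    (* The first inclusion is strict because of x t, the second because of the constant [x], which
       lies in [P] but not in [p]. *)
    split=> [u /(_ 0%N) //|/(_ (Rees xtI))] /=.
    rewrite coefZ coefX mulr0; have [[p0 _ _] _ _] := spec_prime p.
    by move=> /(_ p0)/(_ 1%N); rewrite coefZ coefX mulr1.
  split=> [u|/(_ y)] /=; first exact: pP'.
  by rewrite coefC /= => /(_ (IP _ Ix)).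
have depthQ : ((2%:Z)%:E <= depth (loc Q))%E.
  by apply: le_trans (S2 Q); rewrite le_min lexx.
have y_reg (v w : rees I) : y * v = y * w -> v = w.
  move=> /(congr1 (@rees_val _ _)); rewrite /= => e; apply: val_inj.
  apply/polyP => i.
  by apply: x_reg; rewrite -!coefCM e.
have [||e ze] := depth2_socle (y := to_loc Q y) (z := to_loc Q z) depthQ.
- elim/fracW => w t; rewrite fracM => /fracP[u /=].
  rewrite mul0r mulr1 mulr0 => uyw; apply/fracP; exists u.
  rewrite mulr1 mul0r mulr0; apply: y_reg; rewrite mulr0 -uyw.
  by ring.
- move=> a; rewrite max_idealE => /loc_idealP[]; first by case: (spec_prime Q).
  move=> q [t [Qq ->]].
  (* In degree [k] this holds since the constant coefficient of [q] lies in P = (I^k : g), in higher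
     degrees by [ideal_pow_colon]. *)
  have wI : rees_val q * (g *: 'X^k) \in rees_pred I.
    apply/asboolP => j; rewrite -scalerAr coefZ coefMXn.
    have [jk|kj] := ltnP; first by rewrite mulr0; case: (ideal_pow_ideal I j).
    rewrite -{1}(subnK kj) mulrC; case: (j - k)%N => [//|i].
    exact: ideal_pow_colon (rees_coef q _).
  have qz : q * z = y * Rees wI.
    by apply: val_inj; rewrite /= -!mul_polyC polyCM; ring.
  exists (frac (Rees wI) t); rewrite !fracM; apply: eq_frac; rewrite qz /=.
  by ring.
elim/fracW: e ze => w t; rewrite fracM => /fracP[u /= e].
have {e} : z * (sval u * sval t) = y * (w * sval u).
  by transitivity (sval u * (z * (1 * sval t))); [ring|rewrite e; ring].
(* Comparing coefficients of t^k and cancelling [x] shows that the constant coefficient of u t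
   multiplies [g] into I^k, so lies in [P]; but u t is outside [Q]. *)
move=> /(congr1 (fun v : rees I => (rees_val v)`_k)).
rewrite /= -scalerAl coefZ coefXnM ltnn subnn coefCM -mulrA.
move=> /x_reg e; apply: (@loc_denP _ _ (loc_denM u t)) => /=.
rewrite mulrC -/g e; exact: (rees_coef (w * sval u)).
Qed.

(** * Passage from the equality to strong persistence *)

Lemma common_denominator (A : comNzRingType) (P : spec A) (J : set A)
    (s : seq A) (a : A) : is_ideal J ->
  (forall y, y \in s -> exists2 u, ~ spec_set P u & J (u * (a * y))) ->
  exists2 u, ~ spec_set P u & forall y, ideal_gen [set` s] y -> J (u * a * y).
Proof.
move=> [J0 JD JM] sP; have [_ P1 PP] := spec_prime P.
(* The product of the factors found for the single generators serves for all of them. *)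
have [u Pu us] : exists2 u, ~ spec_set P u & forall y, y \in s -> J (u * a * y).
  elim: s sP => [|y s IHs] sP; first by exists 1.
  have [v Pv vy] := sP y (mem_head _ _).
  have [z zs|u Pu us] := IHs; first by apply: sP; rewrite inE zs orbT.
  exists (u * v) => [/PP[]//|z]; rewrite inE => /predU1P[->|/us Jz].
    by rewrite -!mulrA; exact: JM.
  by rewrite [u * v]mulrC -!mulrA [u * _]mulrA; exact: JM.
exists u => //; apply: (@ideal_gen_sub _ _ [set y | J (u * a * y)]); last by [].
split=> [|x y Jx Jy|b x Jx] /=; first by rewrite mulr0.
  by rewrite mulrDr; exact: JD.
by rewrite mulrCA; exact: JM.
Qed.

Theorem theorem1p4 (R : comNzRingType) (I : set R)
    (noethR : noetherian R)
    (idealI : is_ideal I) (properI : I <> setT)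
    (gradeI : exists2 x : R, I x & GRing.lreg x)
    (infinite_res : forall P : spec R, I `<=` P -> residue_infinite (loc P))
    (S2_rees : serre_S2 (rees I)) :
  strong_persistence I /\
  forall k : nat, colon (ideal_pow I k.+1) I = ideal_pow I k.
Proof.
have colonI k : colon (ideal_pow I k.+1) I = ideal_pow I k.
  exact: colon_pow_S2.
split=> // P IP k f _ [_ nf]; apply: contrapT => nog; apply: nf.
have {nog} fI g : loc_ideal I g -> ideal_pow (loc_ideal I) k.+1 (f * g).
  by move=> Ig; apply: contrapT => nfg; apply: nog; exists g.
elim/fracW: f fI => a s fI; have [l Il] := noethR I idealI.
(* Clearing denominators on the generators of I gives [u] outside [P] with u a I inside I^(k+1).
   Then u a lies in I^k, and a/s = (u a)/(u s). *)
have [y yl|u Pu uI] := common_denominator (P := P) (s := l) (a := a)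
    (ideal_pow_ideal I k.+1).
  apply: (loc_ideal_frac (s := loc_denM s (loc_den1 P))).
    exact: ideal_pow_ideal.
  rewrite -loc_ideal_pow // -fracM; apply: fI; apply: sub_ideal_gen.
  by exists y => //; rewrite Il; exact: sub_ideal_gen.
rewrite loc_ideal_pow //; apply/loc_idealP; first exact: ideal_pow_ideal.
exists (u * a), (loc_denM (loc_den_of Pu) s); split.
  by rewrite -colonI => y; rewrite {1}Il; exact: uI.
by apply: eq_frac => /=; ring.
Qed.
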